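(* Let $n\ge 3$ and let $P_n=\mathrm{Cay}(S_n,\{r_2,\dots,r_n\})$ be the pancake graph. Zaks' tower $(r_2,\dots,r_n)$ is the only tower inside $P_n$ (i.e. the only tower $(g_2,\dots,g_n)$ with all $g_k\in\{r_2,\dots,r_n\}$), and the genlex Hamiltonian cycles of $P_n$ are exactly the $(n-1)!/2$ left translates of Zaks' cycle, the cycle of Zaks' tower.
   Context: $S_n$ is the group of permutations of $\{1,\dots,n\}$, with one-line notation $\pi=\pi_1\cdots\pi_n$; products are $(\pi g)(i)=\pi(g(i))$, so operations act on positions on the right. $r_k\in S_n$ is the reversal of the first $k$ letters: $r_k(i)=k+1-i$ for $i\le k$, $r_k(i)=i$ for $i>k$. In Cayley graphs edges are $\{\pi,\pi g\}$, $g$ a generator. For $1\le k\le n$, $G_k=\mathrm{Sym}\{1,\dots,k\}$ is the subgroup of permutations fixing each of $k+1,\dots,n$. A $k$-cycle on $\{1,\dots,k\}$ is an element of $G_k$ that is a single cycle of length $k$. A tower is a sequence $(g_2,\dots,g_n)$ with $g_k\in G_k\setminus G_{k-1}$ such that, setting $g_1:=\mathbf 1$, each $u_k:=g_{k-1}^{-1}g_k$ is a $k$-cycle on $\{1,\dots,k\}$ $(2\le k\le n)$. Words: $M_1=\varepsilon$ and $M_k=(M_{k-1}\,g_k)^{k-1}M_{k-1}$ for $2\le k\le n$. Write $M_ng_n=w_1\cdots w_{n!}$ and $p_m=w_1\cdots w_m$ ($p_0=\mathbf 1$). The cycle of the tower is the Hamiltonian cycle $p_0,p_1,\dots,p_{n!-1},p_{n!}=p_0$.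 Cycles are regarded as sets of undirected edges; the left translate of a cycle by $g\in S_n$ is its image under $\sigma\mapsto g\sigma$. A Hamiltonian cycle on $S_n$ is genlex when, for every $k$, the permutations agreeing in their last $n-k$ letters (equivalently, each left coset $\pi G_k$) occupy a contiguous arc of the cycle. *)

(* Defs.v *)
From mathcomp Require Import all_boot all_fingroup.

Set Implicit Arguments.
Unset Strict Implicit.
Unset Printing Implicit Defensive.

(* Letters and positions 1, ..., n are shifted to 0, ..., n-1, the elements of
   'I_n; the indices k of r_k, G_k, g_k and M_k are not shifted. *)

(* MathComp's product of permutations is (s * t) x = t (s x); the product used
   here is composition, (pi ** g) i = pi (g i). *)
Definition pmul (n : nat) (pi g : {perm 'I_n}) : {perm 'I_n} := (g * pi)%g.

Notation "x ** y" := (pmul x y) (at level 40, left associativity).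

(* For k <= n, [insubd i] never takes its default value in the branch i < k. *)
Definition pancake_flip_fun (n k : nat) (i : 'I_n) : 'I_n :=
  if i < k then insubd i (k.-1 - i) else i.

Lemma pancake_flip_funK (n k : nat) : involutive (@pancake_flip_fun n k).
Proof.
case: k => [|k] i; rewrite /pancake_flip_fun /= ?ltn0 //.
case: (ltnP i k.+1) => [ik|ki]; last by rewrite ltnNge ki.
have [rn|nr] := ltnP (k - i) n.
  have vr : val (insubd i (k - i) : 'I_n) = k - i by rewrite val_insubd rn.
  rewrite vr ltnS leq_subr; apply: val_inj; rewrite val_insubd vr.
  by rewrite subKn // ltn_ord.
have -> : insubd i (k - i) = i.
  by apply: val_inj; rewrite val_insubd ltnNge nr.
by rewrite ik; apply: val_inj; rewrite val_insubd ltnNge nr.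
Qed.

Definition pancake_flip (n k : nat) : {perm 'I_n} :=
  perm (inv_inj (@pancake_flip_funK n k)).

Definition pancake_gens (n : nat) : {set {perm 'I_n}} :=
  [set pancake_flip n k | k : 'I_n.+1 & 2 <= k].

Definition cayley_edges (n : nat) (S : {set {perm 'I_n}}) :
    {set {set {perm 'I_n}}} :=
  [set [set pi; pi ** g] | pi : {perm 'I_n}, g : {perm 'I_n} in S].

Definition first_letters (n k : nat) : {set 'I_n} := [set i : 'I_n | i < k].

Definition symG (n k : nat) : {set {perm 'I_n}} := Sym (first_letters n k).

Definition is_kcycle (n k : nat) (u : {perm 'I_n}) : Prop :=
  u \in symG n k /\ first_letters n k \in porbits u.

(* A sequence (g_2, ..., g_n) is an (n-1)-tuple; [entry g k] is g_k for
   1 <= k <= n, with g_1 = 1. *)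
Definition entry (n : nat) (g : n.-1.-tuple {perm 'I_n}) (k : nat) :
  {perm 'I_n} := nth 1%g (1%g :: g) k.-1.

Definition is_tower (n : nat) (g : n.-1.-tuple {perm 'I_n}) : Prop :=
  forall k : nat, 2 <= k <= n ->
    entry g k \in symG n k :\: symG n k.-1 /\
    is_kcycle k ((entry g k.-1)^-1%g ** entry g k).

Definition zaks_tower (n : nat) : n.-1.-tuple {perm 'I_n} :=
  [tuple pancake_flip n i.+2 | i < n.-1].

(* Starting from M_0 = [::], the recursion gives M_1 = [::]. *)
Fixpoint tower_word (n : nat) (g : n.-1.-tuple {perm 'I_n}) (k : nat) :
    seq {perm 'I_n} :=
  if k is k'.+1 then
    flatten (nseq k' (rcons (tower_word g k') (entry g k))) ++ tower_word g k'
  else [::].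

Definition prefix_prod (n : nat) (w : seq {perm 'I_n}) (m : nat) :
  {perm 'I_n} := foldl (@pmul n) 1%g (take m w).

Definition tower_cycle (n : nat) (g : n.-1.-tuple {perm 'I_n}) :
    {set {set {perm 'I_n}}} :=
  let w := rcons (tower_word g n) (entry g n) in
  [set [set prefix_prod w m; prefix_prod w m.+1] | m : 'I_(n`!)].

Definition left_translate (n : nat) (g : {perm 'I_n})
    (E : {set {set {perm 'I_n}}}) : {set {set {perm 'I_n}}} :=
  [set [set g ** sigma | sigma in e] | e : {set {perm 'I_n}} in E].

(* [s] lists S_n once, in the cyclic order of the cycle with edge set [E]. *)
Definition traverses (n : nat) (s : seq {perm 'I_n})
    (E : {set {set {perm 'I_n}}}) : Prop :=
  [/\ uniq s, forall pi, pi \in s & E = [set [set pi; next s pi] | pi in s]].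

Definition hamiltonian_cycle (n : nat) (E : {set {set {perm 'I_n}}}) : Prop :=
  exists s, traverses s E.

Definition contiguous (n : nat) (s : seq {perm 'I_n}) (A : {set {perm 'I_n}}) :
  Prop := exists i m : nat, A = [set sigma in take m (rot i s)].

(* The permutations agreeing with [pi] in their last n-k letters. *)
Definition tail_class (n k : nat) (pi : {perm 'I_n}) : {set {perm 'I_n}} :=
  [set sigma : {perm 'I_n} | [forall i : 'I_n, (k <= i) ==> (sigma i == pi i)]].

(* For n >= 3 the edge set determines [s] up to rotation and reversal, neither
   of which affects contiguity, so the choice of [s] is immaterial. *)
Definition genlex (n : nat) (E : {set {set {perm 'I_n}}}) : Prop :=
  exists2 s, traverses s E &
    forall (k : nat) (pi : {perm 'I_n}), 1 <= k <= n ->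
      contiguous s (tail_class k pi).

(* Main.v *)
Require Import Defs.
From mathcomp Require Import all_boot all_fingroup.
From mathcomp Require Import zify.

Set Implicit Arguments.
Unset Strict Implicit.
Unset Printing Implicit Defensive.

(** Label each step of a walk in the pancake graph by the index of the reversal
    that it uses.  In Zaks' word the [m]-th letter is [r_l], where [l] is the
    largest index [<= n] such that [(l-1)!] divides [m]; write [l = ruler n m].

    A genlex cycle has no choice but to follow this ruler.  Start it where it
    enters a coset of [G_(n-1)].  Every coset of [G_k], [k < n], is an arc of
    [k!] vertices, and an arc that does not fill the cycle is entered at one
    vertex only.  So, once one entrance is known, the cosets of [G_k] occupy
    exactly the blocks of positions between consecutive multiples of [k!]
    ([aligned_blocks]).  Entering a coset of [G_(n-1)] is also entering a coset
    of each smaller [G_k], so the same starting point serves for every [k].  The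
    [m]-th step, by [r_l], leaves the coset of [G_k] iff [k < l], and by the
    above iff [k!] divides [m].  This determines [l = ruler n m], and the cycle
    is the left translate of Zaks' cycle by its starting point
    ([genlex_pancake]).

    Conversely, the vertices [zaks n m] of Zaks' walk satisfy
    [zaks n (q k! + t) = zaks n (q k!) ** zaks n t] for [t < k!].  The second
    factor lies in [G_k], and for [q <= k < n] the first one is the [q]-th power
    of the rotation [r_k r_(k+1)] of the first [k+1] letters ([zaks_block]).  So
    two vertices with indices below [n!] lie in the same coset of [G_k] iff
    their indices have the same quotient by [k!] ([zaks_tail]).  The case
    [k = 0] says that the walk is a Hamiltonian cycle, the others that it is
    genlex.

    To count the translates, consider which translations preserve the cycle.
    Such a translation, by [x] say, sends the edge [{r_n, 1}], labelled [r_n], to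
    the edge [{x r_n, x}] with the same label, so [x] is one of the [2 n] ends of
    the edges labelled [r_n].  All of these work, because the cyclic word is
    invariant under shifts by [(n-1)!] and under reversal
    ([translate_zaks_fixed]).  Hence there are [n! / (2 n)] translates. *)

(** * Composition and prefix reversals *)

Lemma pmulE n (x y : {perm 'I_n}) i : (x ** y) i = x (y i).
Proof. by rewrite permM. Qed.

Lemma pmulA n (x y z : {perm 'I_n}) : x ** (y ** z) = x ** y ** z.
Proof. by rewrite /pmul mulgA. Qed.

Lemma pmulI n (x : {perm 'I_n}) : injective (pmul x).
Proof. exact: mulIg. Qed.

Lemma flipE n k (i : 'I_n) : k <= n ->
  pancake_flip n k i = (if i < k then k.-1 - i else i) :> nat.
Proof.
move=> kn; rewrite permE /pancake_flip_fun; case: ltnP => // ik.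
by rewrite val_insubd ifT //; lia.
Qed.

Lemma flipK n k : pancake_flip n k ** pancake_flip n k = 1%g.
Proof. by apply/permP => i; rewrite pmulE perm1 !permE pancake_flip_funK. Qed.

Lemma flipV n k : (pancake_flip n k)^-1%g = pancake_flip n k.
Proof. by apply/eqP; rewrite eq_invg_mul; apply/eqP/flipK. Qed.

Lemma flip1 n : pancake_flip n 1 = 1%g.
Proof.
apply/permP => i; apply: val_inj; rewrite perm1 /= flipE; last first.
  by have := ltn_ord i; lia.
by case: ltnP => //; lia.
Qed.

(** For [k >= 2] the last position moved by [r_k] is [k], while [r_1 = 1] moves
    none. *)
Lemma flip_inj n j k : 0 < k <= n -> 2 <= j <= n ->
  pancake_flip n j = pancake_flip n k -> j = k.
Proof.
move=> hk hj e; have jn : j.-1 < n by lia.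
have kn : k.-1 < n by lia.
have := congr1 val (congr1 (fun s : {perm _} => s (Ordinal jn)) e).
have := congr1 val (congr1 (fun s : {perm _} => s (Ordinal kn)) e).
rewrite /= !flipE /=; try lia.
by do !case: ifP; lia.
Qed.

Lemma symGP n k (x : {perm 'I_n}) :
  reflect (forall i : 'I_n, k <= i -> x i = i) (x \in symG n k).
Proof.
rewrite !inE; apply: (iffP subsetP) => h i => [ki|].
  by apply/eqP; apply: contraTT ki => xi; have := h i xi; rewrite inE -ltnNge.
by rewrite inE; apply: contraNT; rewrite inE -leqNgt => /h ->.
Qed.

Lemma flip_symG n j k : j <= k -> j <= n -> pancake_flip n j \in symG n k.
Proof.
move=> jk jn; apply/symGP => i ki; apply: val_inj; rewrite /= flipE //.
by case: ltnP => //; lia.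
Qed.

Lemma flip_notin_symG n j k : k < j -> 2 <= j <= n ->
  pancake_flip n j \notin symG n k.
Proof.
move=> kj hj; have jn : j.-1 < n by lia.
apply/negP => /symGP /(_ (Ordinal jn)) /= h.
have {h} /(congr1 val) := h ltac:(lia).
by rewrite /= flipE /=; [case: ifP; lia | lia].
Qed.

Lemma pancake_gensP n (x : {perm 'I_n}) :
  reflect (exists2 k, 2 <= k <= n & x = pancake_flip n k)
          (x \in pancake_gens n).
Proof.
apply: (iffP imsetP) => [[k]|[k /andP[k2 kn] ->]].
  by rewrite inE => k2 ->; exists k; rewrite // k2 -ltnS ltn_ord.
have kS : k < n.+1 by [].
by exists (Ordinal kS); rewrite ?inE.
Qed.

(** * Zaks' tower *)

Definition rotation n k : {perm 'I_n} :=
  pancake_flip n k ** pancake_flip n k.+1.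

(** The rotation sends [i] to [i - 1] and [0] to [k], positions being counted
    from 0. *)
Lemma rotationXE n k j (i : 'I_n) : k < n -> j <= k.+1 ->
  (rotation n k ^+ j)%g i =
  (if k < i then i : nat else if j <= i then i - j else i + k.+1 - j) :> nat.
Proof.
move=> kn; elim: j => [|j IHj] jk.
  by rewrite expg0 perm1 subn0; case: ifP.
rewrite expgSr permM pmulE flipE; last by lia.
rewrite !flipE // IHj; last by lia.
have := ltn_ord i.
by do !case: ifP; lia.
Qed.

Lemma rotation_order n k : k < n -> (rotation n k ^+ k.+1)%g = 1%g.
Proof.
move=> kn; apply/permP => i; apply: val_inj; rewrite /= perm1 rotationXE //.
by do !case: ifP; lia.
Qed.

Lemma rotation_kcycle n k : k < n -> is_kcycle k.+1 (rotation n k).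
Proof.
move=> kn; split.
  rewrite groupM ?flip_symG //; lia.
apply/imsetP; exists (Ordinal kn) => //.
apply/setP => i; rewrite inE; apply/idP/porbitP => [ik|[j ->]].
  exists (k - i); apply: val_inj; rewrite /= rotationXE /=; try lia.
  by do !case: ifP; lia.
rewrite -(expg_mod _ (rotation_order kn)) rotationXE //=.
  by do !case: ifP; lia.
by rewrite ltnW // ltn_pmod.
Qed.

Lemma entryE n (g : n.-1.-tuple {perm 'I_n}) k :
  entry g k.+2 = nth 1%g g k.
Proof. by []. Qed.

Lemma entry_zaks n k : 0 < k <= n ->
  entry (zaks_tower n) k = pancake_flip n k.
Proof.
case: k => [|[|k]] // kn; first by rewrite flip1.
have kn' : k < n.-1 by lia.
by rewrite entryE -(tnth_nth _ _ (Ordinal kn')) tnth_mktuple.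
Qed.

Lemma zaks_is_tower n : is_tower (zaks_tower n).
Proof.
case=> [|[|k]] // kn; rewrite !entry_zaks //; try lia.
split; last by rewrite flipV; apply: rotation_kcycle; lia.
by rewrite in_setD flip_notin_symG ?flip_symG //; lia.
Qed.

Lemma zaks_in_pancake n x : x \in zaks_tower n -> x \in pancake_gens n.
Proof.
case/tnthP=> i ->; rewrite tnth_mktuple; apply/pancake_gensP.
by exists i.+2 => //; have := ltn_ord i; lia.
Qed.

(** Only one reversal lies in [G_k] but not in [G_(k-1)]. *)
Lemma pancake_tower n (g : n.-1.-tuple {perm 'I_n}) :
  is_tower g -> (forall x, x \in g -> x \in pancake_gens n) ->
  g = zaks_tower n.
Proof.
move=> tg gP; apply: eq_from_tnth => i; rewrite tnth_mktuple.
have lti := ltn_ord i.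
have /gP/pancake_gensP[k hk def] := mem_tnth i g.
have [] := tg i.+2 ltac:(lia); rewrite entryE -tnth_nth def in_setD.
case/andP=> h1 h2 _.
have [ki|ik] := leqP k i.+1; first by rewrite flip_symG ?ki // in h1; lia.
have [ik'|ki'] := ltnP i.+2 k.
  by rewrite (negPf (flip_notin_symG _ _)) in h2.
by congr pancake_flip; lia.
Qed.

(** * The ruler sequence *)

Lemma leq_dvdn_fact a b : a <= b -> a`! %| b`!.
Proof.
move=> /subnKC <-; elim: (b - a) => [|d IHd]; first by rewrite addn0.
by rewrite addnS factS dvdn_mull.
Qed.

(** The largest [k <= n] such that [(k-1)!] divides [m]. *)
Fixpoint ruler n m : nat :=
  if n is k.+1 then if k`! %| m then n else ruler k m else 0.

Lemma ruler_le n m : ruler n m <= n.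
Proof. by elim: n => //= n IHn; case: ifP => // _; apply: leqW. Qed.

Lemma ruler_gt1 n m : 2 <= n -> 2 <= ruler n m.
Proof.
elim: n => [|[|[|n]] IHn] //= _; first by rewrite dvd1n.
by case: ifP => // _; apply: IHn.
Qed.

(** The values above [k] mark the multiples of [k!]: going down from [n], the
    recursion stops above [k] as soon as some [l!] with [l >= k] divides [m], and
    then so does [k!]. *)
Lemma ltn_ruler n m k : k < n -> (k < ruler n m) = (k`! %| m).
Proof.
elim: n => //= n IHn; case: ifP => [nm|nm].
  rewrite ltnS => kn; rewrite kn; apply/esym/(dvdn_trans _ nm).
  exact: leq_dvdn_fact.
rewrite ltnS leq_eqVlt => /orP[/eqP->|/IHn //].
by rewrite nm ltnNge ruler_le.
Qed.

Lemma ruler_unique n m r : 2 <= n -> 2 <= r <= n ->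
  (forall k, 1 <= k < n -> (k < r) = (k`! %| m)) -> r = ruler n m.
Proof.
move=> n2 /andP[r2 rn] rP; have Rn := ruler_le n m; have R2 := ruler_gt1 m n2.
apply/eqP; rewrite eqn_leq; apply/andP; split; rewrite leqNgt; apply/negP => lt.
  have Rlt : ruler n m < n by exact: leq_trans lt rn.
  by have := rP (ruler n m); rewrite -(ltn_ruler m Rlt) ltnn lt Rlt; lia.
have rlt : r < n by exact: leq_trans lt Rn.
by have := rP r; rewrite ltnn -(ltn_ruler m rlt) lt rlt; lia.
Qed.

(** The symmetries of the ruler below all come from the fact that it sees [m]
    only through its divisibility by factorials. *)
Lemma eq_ruler n a b :
  (forall k, k < n -> (k`! %| a) = (k`! %| b)) -> ruler n a = ruler n b.
Proof.
elim: n => //= n IHn ab; rewrite ab // IHn // => k kn.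
by apply: ab; apply: ltnW.
Qed.

Lemma ruler_period n d m : n.-1`! %| d -> ruler n (d + m) = ruler n m.
Proof.
move=> dn; apply: eq_ruler => k kn; rewrite dvdn_addr //.
by apply: dvdn_trans dn; apply: leq_dvdn_fact; lia.
Qed.

Lemma ruler_opp n m : m <= n`! -> ruler n (n`! - m) = ruler n m.
Proof.
move=> mn; apply: eq_ruler => k kn; rewrite dvdn_subr //.
by apply: leq_dvdn_fact; apply: ltnW.
Qed.

Lemma ruler_inner n k q i : 0 < i < k`! -> ruler n (q * k`! + i) = ruler n i.
Proof.
case/andP=> i0 ik; apply: eq_ruler => l _.
have [lk|kl] := leqP l k.
  by rewrite dvdn_addr // dvdn_mull // leq_dvdn_fact.
have kln : k`! %| l`! by apply/leq_dvdn_fact/ltnW.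
have ki : (k`! %| i) = false by rewrite gtnNdvd.
apply/idP/idP => /(dvdn_trans kln); last by rewrite ki.
by rewrite dvdn_addr ?ki // dvdn_mull.
Qed.

(** Unlike in [ruler_inner], the end [i = k!] of the block is included: the
    position [(j+1) k!] is not a multiple of [(k+1)!] as long as [j < k]. *)
Lemma ruler_block n k j i : j < k -> 0 < i <= k`! ->
  ruler n (j * k`! + i) = ruler n i.
Proof.
move=> jk /andP[i0 ik]; apply: eq_ruler => l _.
have [lk|kl] := leqP l k; first by rewrite dvdn_addr // dvdn_mull // leq_dvdn_fact.
have lt : (k.+1)`! <= l`! by rewrite dvdn_leq ?fact_gt0 // leq_dvdn_fact.
have k0 := fact_gt0 k.
have jk' : j.+1 * k`! <= k * k`! by rewrite leq_mul2r jk orbT.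
by rewrite factS in lt; rewrite !gtnNdvd //; lia.
Qed.

(** * Zaks' sequence *)

(** The [m]-th vertex of Zaks' cycle, continued periodically to all [m]. *)
Fixpoint zaks n m : {perm 'I_n} :=
  if m is m'.+1 then zaks n m' ** pancake_flip n (ruler n m) else 1%g.

Lemma zaks_add n d m : (forall i, 0 < i <= m -> ruler n (d + i) = ruler n i) ->
  zaks n (d + m) = zaks n d ** zaks n m.
Proof.
elim: m => [|m IHm] dm; first by rewrite addn0 /pmul mul1g.
rewrite addnS /= -addnS dm ?ltnSn // IHm ?pmulA // => i im.
by apply: dm; lia.
Qed.

Lemma zaks_symG n k m : k <= n -> m < k`! -> zaks n m \in symG n k.
Proof.
move=> kn; elim: m => [|m IHm] mk; first exact: group1.
rewrite groupM ?IHm ?(ltnW mk) // flip_symG ?ruler_le //.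
have := ruler_le n m.+1; rewrite [k <= n]leq_eqVlt in kn.
case/orP: kn => [/eqP->|kn _] //.
by rewrite leqNgt ltn_ruler // gtnNdvd.
Qed.

Lemma zaks_inner n k q t : t < k`! ->
  zaks n (q * k`! + t) = zaks n (q * k`!) ** zaks n t.
Proof. by move=> tk; apply: zaks_add => i ht; apply: ruler_inner; lia. Qed.

Lemma ruler_fact n k : 0 < k < n -> ruler n k`! = k.+1.
Proof.
case/andP=> k0 kn; apply/esym/ruler_unique; try lia.
move=> l /andP[l0 ln]; rewrite ltnS; apply/idP/idP => [/leq_dvdn_fact //|].
apply: contraTT; rewrite -ltnNge => kl; rewrite gtnNdvd ?fact_gt0 //.
by rewrite ltn_fact.
Qed.

(** The product of [M_k] is [r_k], so [M_k r_(k+1)] multiplies to the rotation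
    of the first [k+1] letters, whose powers lead from one coset of [G_k] to the
    next.  Its [(k+1)]-st power is 1, and [M_(k+1) r_(k+1)] multiplies to that
    power; so the product of [M_(k+1)] is [r_(k+1)]. *)
Lemma zaks_block n k : 0 < k <= n -> zaks n (k`!).-1 = pancake_flip n k /\
  (k < n -> forall j, j <= k -> zaks n (j * k`!) = (rotation n k ^+ j)%g).
Proof.
elim: k => // k IHk /andP[_ kn].
have first_part : zaks n (k.+1`!).-1 = pancake_flip n k.+1.
  case: k => [|k] in IHk kn *; first by rewrite flip1.
  have [IH1 IH2] := IHk ltac:(lia).
  have f0 := fact_gt0 k.+1.
  have -> : (k.+2`!).-1 = k.+1 * k.+1`! + (k.+1`!).-1 by rewrite factS; lia.
  rewrite zaks_inner ?prednK // IH1 IH2 //.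
  have -> : (rotation n k.+1 ^+ k.+1)%g = (rotation n k.+1)^-1%g.
    by apply/esym/eqP; rewrite eq_invg_mul -expgS rotation_order.
  by rewrite /rotation /pmul invMg mulKVg flipV.
split=> // kn' j; elim: j => [|j IHj] jk; first by rewrite mul0n.
rewrite mulSnr zaks_add => [|i hi]; last by apply: ruler_block.
rewrite IHj ?(ltnW jk) // expgS; congr (_ ** _).
rewrite -[X in zaks n X]prednK ?fact_gt0 //= first_part prednK ?fact_gt0 //.
by rewrite ruler_fact.
Qed.

Lemma zaks_fact_pred n k : 0 < k <= n -> zaks n (k`!).-1 = pancake_flip n k.
Proof. by case/zaks_block. Qed.

Lemma zaks_rotation n k j : 0 < k < n -> j <= k ->
  zaks n (j * k`!) = (rotation n k ^+ j)%g.
Proof.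
by case/andP=> k0 kn; case: (@zaks_block n k) => [|_]; [lia | apply].
Qed.

Lemma ruler_top n m : 0 < n -> n.-1`! %| m -> ruler n m = n.
Proof. by case: n => //= n _ ->. Qed.

Lemma ruler_full n : 0 < n -> ruler n n`! = n.
Proof. by move=> n0; rewrite ruler_top // leq_dvdn_fact // leq_pred. Qed.

Lemma zaks_full n : 0 < n -> zaks n n`! = 1%g.
Proof.
move=> n0; rewrite -[X in zaks n X]prednK ?fact_gt0 //= prednK ?fact_gt0 //.
by rewrite zaks_fact_pred ?n0 ?leqnn // ruler_full // flipK.
Qed.

Lemma zaks_period n d m : n.-1`! %| d -> zaks n (d + m) = zaks n d ** zaks n m.
Proof. by move=> dn; apply: zaks_add => i _; apply: ruler_period. Qed.

Lemma zaks_modn n m : 0 < n -> zaks n (m %% n`!) = zaks n m.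
Proof.
move=> n0; have dn : n.-1`! %| n`! by apply: leq_dvdn_fact; lia.
rewrite [in RHS](divn_eq m n`!); elim: (m %/ _) => [|q IHq] //.
by rewrite mulSn -addnA zaks_period // zaks_full // /pmul mulg1.
Qed.

(** For [a < m!], the letter of [zaks n a] in the [m]-th place is [m - q], where
    [q] is the quotient of [a] by [(m-1)!]: the tail reads off the leading
    factorial digit of [a].  Peeling off the digits one at a time gives the
    quotient by [k!]. *)
Lemma zaks_tail_inj n m a b k : m <= n -> a < m`! -> b < m`! ->
  (forall i : 'I_n, k <= i -> zaks n a i = zaks n b i) -> a %/ k`! = b %/ k`!.
Proof.
elim: m a b => [|m IHm] a b mn am bm ab.
  by move: am bm; rewrite fact0; case: a b {ab} => // -[].
have [mk|km] := leqP m.+1 k.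
  have le := dvdn_leq (fact_gt0 k) (leq_dvdn_fact mk).
  by rewrite !divn_small // ?(leq_trans am) ?(leq_trans bm).
have f0 := fact_gt0 m.
case: m => [|m] in IHm mn am bm km f0 *.
  by move: am bm; rewrite factS fact0; case: a b {ab} => // -[].
have topP c : c < m.+2`! -> zaks n c (Ordinal mn) = m.+1 - c %/ m.+1`! :> nat.
  move=> cm; rewrite {1}(divn_eq c m.+1`!) zaks_inner ?ltn_mod // pmulE.
  have /symGP -> // := zaks_symG (ltnW mn) (ltn_pmod c f0).
  rewrite factS in cm; have ck : c %/ m.+1`! < m.+2 by rewrite ltn_divLR.
  rewrite zaks_rotation // rotationXE //=; last by lia.
  by do !case: ifP; lia.
have eq_q : a %/ m.+1`! = b %/ m.+1`!.
  have := congr1 val (ab (Ordinal mn) km); rewrite /= !topP //.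
  have : a %/ m.+1`! < m.+2 by rewrite ltn_divLR // -factS.
  have : b %/ m.+1`! < m.+2 by rewrite ltn_divLR // -factS.
  by lia.
have kd : k`! %| m.+1`! by apply: leq_dvdn_fact.
rewrite (divn_eq a m.+1`!) (divn_eq b m.+1`!) eq_q !divnDl ?(dvdn_mull _ kd) //.
congr addn; apply: IHm; rewrite ?ltn_mod // ?(ltnW mn) // => i ki.
have := ab i ki; rewrite {1}(divn_eq a m.+1`!) {1}(divn_eq b m.+1`!) eq_q.
by rewrite !zaks_inner ?ltn_mod // !pmulE; apply: perm_inj.
Qed.

Lemma zaks_inj n a b : 0 < n -> (zaks n a == zaks n b) = (a == b %[mod n`!]).
Proof.
move=> n0; apply/eqP/eqP => e; last by rewrite -zaks_modn // e zaks_modn.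
rewrite -[LHS]divn1 -[RHS]divn1 -[1]/(0`!).
apply: (@zaks_tail_inj n n); rewrite ?ltn_mod ?fact_gt0 // => i _.
by rewrite !zaks_modn // e.
Qed.

Lemma zaks_tail n a b k : k <= n -> a < n`! -> b < n`! ->
  (zaks n a \in tail_class k (zaks n b)) = (a %/ k`! == b %/ k`!).
Proof.
move=> kn an bn; rewrite inE; apply/forallP/eqP => [e|e i].
  apply: (@zaks_tail_inj n n) => // i ki.
  by apply/eqP; have /implyP := e i; apply.
apply/implyP => ki; have f0 := fact_gt0 k.
rewrite (divn_eq a k`!) (divn_eq b k`!) e !zaks_inner ?ltn_mod // !pmulE.
have /symGP -> // := zaks_symG kn (ltn_pmod a f0).
by have /symGP -> // := zaks_symG kn (ltn_pmod b f0).
Qed.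

(** Left multiplication by [r_n] runs the walk backwards, since the ruler is a
    palindrome. *)
Lemma zaks_reflect n m : 0 < n -> m < n`! ->
  pancake_flip n n ** zaks n m = zaks n (n`!.-1 - m).
Proof.
move=> n0; elim: m => [|m IHm] mn.
  by rewrite subn0 zaks_fact_pred ?n0 //= /pmul mul1g.
rewrite /= pmulA IHm ?(ltnW mn) //.
have -> : n`!.-1 - m = (n`!.-1 - m.+1).+1 by lia.
rewrite /=; have -> : (n`!.-1 - m.+1).+1 = n`! - m.+1 by lia.
by rewrite ruler_opp ?(ltnW mn) // -pmulA flipK /pmul mul1g.
Qed.

(** * The word of Zaks' tower *)

Definition zaks_letter n m := pancake_flip n (ruler n m.+1).

Lemma zaks_word n k : 0 < k <= n ->
  tower_word (zaks_tower n) k = mkseq (zaks_letter n) k`!.-1.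
Proof.
elim: k => // k IHk /andP[_ kn].
case: k => [|k] in IHk kn *; first by [].
have f0 := fact_gt0 k.+1.
rewrite -[LHS]/(flatten (nseq k.+1 (rcons (tower_word _ k.+1) _))
                ++ tower_word _ k.+1).
rewrite IHk ?(ltnW kn) //.
rewrite entry_zaks //.
set W := rcons _ _.
have WE : W = mkseq (zaks_letter n) k.+1`!.
  rewrite -[in RHS](prednK f0) mkseqS /W /zaks_letter prednK //.
  by rewrite ruler_fact.
have blocks j : j <= k.+1 ->
    flatten (nseq j W) = mkseq (zaks_letter n) (j * k.+1`!).
  elim: j => [|j IHj] jk; first by [].
  rewrite -addn1 nseqD flatten_cat IHj ?(ltnW jk) //= cats0 WE.
  rewrite mulnDl mul1n /mkseq iotaD map_cat; congr (_ ++ _).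
  rewrite add0n -[in RHS](addn0 (j * _)) iotaDl -map_comp.
  apply/eq_in_map => i; rewrite mem_iota add0n /= => ik.
  by rewrite /zaks_letter -addnS ruler_block.
rewrite blocks //.
have -> : k.+2`!.-1 = k.+1 * k.+1`! + k.+1`!.-1 by rewrite factS; lia.
rewrite /mkseq [in RHS]iotaD map_cat; congr (_ ++ _).
rewrite add0n -[in RHS](addn0 (_ * _)) iotaDl -map_comp.
apply/eq_in_map => i; rewrite mem_iota add0n /= => ik.
by rewrite /zaks_letter -addnS ruler_inner //; lia.
Qed.

Lemma zaks_prefix n m : 2 <= n -> m <= n`! ->
  prefix_prod (rcons (tower_word (zaks_tower n) n) (entry (zaks_tower n) n)) m
  = zaks n m.
Proof.
move=> n2 mn; have f0 := fact_gt0 n.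
rewrite zaks_word ?entry_zaks; try lia.
have -> : pancake_flip n n = zaks_letter n n`!.-1.
  by rewrite /zaks_letter prednK // ruler_full // ltnW.
rewrite -mkseqS prednK // /prefix_prod.
elim: m mn => [|m IHm] mn; first by rewrite take0.
rewrite (take_nth 1%g) ?size_mkseq // foldl_rcons IHm ?(ltnW mn) //.
by rewrite nth_mkseq.
Qed.

(** * Closed walks through all permutations *)

Section Listing.

Variables (T : finType) (N : nat).
Implicit Types (f : nat -> T) (A : {set T}).

(** A cyclic order of [N] elements is unrolled to an [N]-periodic sequence, so
    that moving the origin is a shift of the index and no arc wraps around. *)
Definition cyclic_listing f := forall a b, (f a == f b) = (a == b %[mod N]).

Definition listing_edges f : {set {set T}} :=
  [set [set f m; f m.+1] | m : 'I_N].

Definition listing_arc f i m : {set T} := [set f (i + val t) | t : 'I_m].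

Lemma arcP f i m x :
  reflect (exists2 t, t < m & x = f (i + t)) (x \in listing_arc f i m).
Proof.
apply: (iffP imsetP) => [[t _ ->]|[t tm ->]]; first by exists t.
by exists (Ordinal tm).
Qed.

Lemma listing_congr f a b : cyclic_listing f -> a = b %[mod N] -> f a = f b.
Proof. by move=> fP /eqP; rewrite -fP => /eqP. Qed.

Lemma mem_listing_edges f e : cyclic_listing f -> 0 < N ->
  reflect (exists a, e = [set f a; f a.+1]) (e \in listing_edges f).
Proof.
move=> fP N0; apply: (iffP imsetP) => [[a _ ->]|[a ->]]; first by exists a.
exists (Ordinal (ltn_pmod a N0)) => //=.
rewrite (listing_congr fP (esym (modn_mod a N))).
rewrite [f a.+1](listing_congr fP (b := (a %% N).+1)) //.
by rewrite -addn1 -modnDml addn1.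
Qed.

Lemma cyclic_listing_shift f i :
  cyclic_listing f -> cyclic_listing (fun t => f (i + t)).
Proof. by move=> fP a b; rewrite fP eqn_modDl. Qed.

Lemma listing_edges_shift f i : cyclic_listing f -> 0 < N ->
  listing_edges (fun t => f (i + t)) = listing_edges f.
Proof.
move=> fP N0; have gP := cyclic_listing_shift i fP.
apply/setP => e; apply/(mem_listing_edges e gP N0)/(mem_listing_edges e fP N0).
  by case=> a ->; exists (i + a); rewrite addnS.
case=> a ->; exists (i * N + a - i).
have h : i * N + a = i + (i * N + a - i) by have := leq_pmulr i N0; lia.
rewrite addnS -h.
by congr [set _; _]; apply: listing_congr => //; rewrite -?addnS modnMDl.
Qed.

Lemma arc_shift f i j m : cyclic_listing f -> 0 < N ->
  exists j', listing_arc f j m = listing_arc (fun t => f (i + t)) j' m.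
Proof.
move=> fP N0; exists (j + N * i - i); apply: eq_imset => t.
have -> : i + (j + N * i - i + val t) = i * N + (j + val t).
  by have := leq_pmull i N0; lia.
by apply: listing_congr => //; rewrite modnMDl.
Qed.

Lemma card_arc f i m : cyclic_listing f -> m <= N -> #|listing_arc f i m| = m.
Proof.
move=> fP mN; rewrite card_imset ?card_ord // => u v /eqP.
rewrite fP eqn_modDl (modn_small (leq_trans (ltn_ord u) mN)).
by rewrite (modn_small (leq_trans (ltn_ord v) mN)) => /eqP/val_inj.
Qed.

Lemma mem_long_arc f a i m : cyclic_listing f -> 0 < N -> N <= m ->
  f a \in listing_arc f i m.
Proof.
move=> fP N0 Nm; apply/arcP.
exists ((a + i * N - i) %% N); first by rewrite (leq_trans _ Nm) // ltn_mod.
apply: listing_congr => //; rewrite modnDmr.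
have -> : i + (a + i * N - i) = i * N + a by have := leq_pmulr i N0; lia.
by rewrite modnMDl.
Qed.

(** An arc that misses some element is entered only at its first element, so any
    place of entry is where it begins. *)
Lemma arc_entry f a i m : cyclic_listing f -> 0 < N ->
  f a \notin listing_arc f i m -> f a.+1 \in listing_arc f i m ->
  listing_arc f i m = listing_arc f a.+1 #|listing_arc f i m|.
Proof.
move=> fP N0 aA /arcP[t tm /eqP]; rewrite fP => /eqP ea.
have mN : m <= N.
  by rewrite leqNgt; apply: contra aA => /ltnW; apply: mem_long_arc.
have t0 : t = 0.
  case: t => [//|t] in tm ea *; case/negP: aA; apply/arcP.
  exists t; first exact: ltnW.
  apply: listing_congr => //; apply/eqP; rewrite -(eqn_modDr 1) !addn1 ea.
  by rewrite addnS.
rewrite {t}t0 addn0 in tm ea; rewrite card_arc //; apply: eq_imset => t.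
by apply: listing_congr => //; apply/eqP; rewrite eqn_modDr ea.
Qed.

End Listing.

(** * Traversing a cycle *)

Lemma next_nth_mod (T : eqType) (s : seq T) x0 i : uniq s -> i < size s ->
  next s (nth x0 s i) = nth x0 s (i.+1 %% size s).
Proof.
move=> us lti; rewrite next_nth mem_nth //.
case: s us lti => // y s us lti; rewrite index_uniq //.
have := lti; rewrite /= ltnS leq_eqVlt => /orP[/eqP->|lt].
  by rewrite modnn nth_default.
by rewrite modn_small //= (set_nth_default x0).
Qed.

Lemma size_all_perms n (s : seq {perm 'I_n}) :
  uniq s -> (forall x, x \in s) -> size s = n`!.
Proof.
move=> us sall; rewrite -card_Sn -(card_uniqP us).
by apply: eq_card => x; rewrite sall inE.
Qed.

(** An arc may be given by a length or an offset larger than [n!]; both are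
    first cut down to [n!]. *)
Lemma traverses_listing n (s : seq {perm 'I_n}) E : traverses s E ->
  exists f, [/\ cyclic_listing n`! f, E = listing_edges n`! f
    & forall A, contiguous s A -> exists i m, A = listing_arc f i m].
Proof.
case=> us sall ->; have sN := size_all_perms us sall.
have N0 := fact_gt0 n.
exists (fun a => nth 1%g s (a %% n`!)); split.
- by move=> a b; rewrite nth_uniq // sN ltn_mod.
- apply/setP => e; apply/imsetP/imsetP => [[x _ ->]|[m _ ->]].
    have lti : index x s < n`! by rewrite -sN index_mem.
    exists (Ordinal lti) => //=; rewrite (modn_small lti) nth_index //.
    by rewrite -sN -next_nth_mod ?sN // nth_index.
  exists (nth 1%g s m); first exact: sall.
  by rewrite next_nth_mod ?sN // (modn_small (ltn_ord m)).
move=> A [i [m ->]].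
have rotE j t : j <= n`! -> t < n`! ->
    nth 1%g (rot j s) t = nth 1%g s ((j + t) %% n`!).
  move=> jN tN; rewrite /rot nth_cat size_drop sN nth_drop.
  case: ltnP => h; first by rewrite modn_small //; lia.
  rewrite nth_take; last by lia.
  have -> : j + t = t - (n`! - j) + n`! by lia.
  by rewrite modnDr [in RHS]modn_small //; lia.
wlog iN : i / i <= n`!.
  move=> wl; have [|/ltnW Ni] := leqP i n`!; first exact: wl.
  by rewrite rot_oversize ?sN //; have := wl 0 isT; rewrite rot0.
exists i, (minn m n`!); apply/setP => x; rewrite inE.
apply/(nthP 1%g)/arcP => -[t].
  rewrite size_take size_rot sN => tm <-.
  have tm' : t < minn m n`! by move: tm; case: ifP; lia.
  by exists t => //; rewrite nth_take ?rotE //; lia.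
move=> tm ->; exists t; last by rewrite nth_take ?rotE //; lia.
by rewrite size_take size_rot sN; case: ifP; lia.
Qed.

Lemma listing_onto n (f : nat -> {perm 'I_n}) x :
  cyclic_listing n`! f -> exists2 a, a < n`! & f a = x.
Proof.
move=> fP; have inj : injective (fun a : 'I_(n`!) => f a).
  by move=> a b /eqP; rewrite fP !modn_small // => /eqP/val_inj.
have [|g _ gK] := inj_card_bij inj; first by rewrite card_Sn card_ord.
by exists (g x); rewrite ?gK.
Qed.

Lemma listing_traverses n (f : nat -> {perm 'I_n}) : cyclic_listing n`! f ->
  traverses (mkseq f n`!) (listing_edges n`! f).
Proof.
move=> fP; have us : uniq (mkseq f n`!).
  apply/mkseq_uniqP => a b aN bN /eqP.
  by rewrite fP !modn_small // => /eqP.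
have sall x : x \in mkseq f n`!.
  have [a aN <-] := listing_onto x fP.
  by apply/map_f; rewrite mem_iota.
have nextE a : a < n`! -> next (mkseq f n`!) (f a) = f a.+1.
  move=> aN; have := @next_nth_mod _ (mkseq f n`!) 1%g a us.
  rewrite size_mkseq !nth_mkseq ?ltn_mod ?fact_gt0 // => ->//.
  by apply: listing_congr fP _; rewrite modn_mod.
split=> //; apply/setP => e; apply/imsetP/imsetP => [[m _ ->]|[x _ ->]].
  by exists (f m); rewrite ?nextE //; apply: sall.
by have [a aN <-] := listing_onto x fP; exists (Ordinal aN); rewrite ?nextE.
Qed.

(** Cosets in Zaks' order start at multiples of [k!], so only arcs that stop
    before the origin are needed. *)
Lemma contiguous_mkseq n (f : nat -> {perm 'I_n}) i m :
  i + m <= n`! -> contiguous (mkseq f n`!) (listing_arc f i m).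
Proof.
move=> imN; exists i, m; apply/setP => x; rewrite inE /rot.
rewrite takel_cat ?size_drop ?size_mkseq; last by lia.
rewrite /mkseq -map_drop -map_take drop_iota take_iota add0n.
rewrite (minn_idPl _); last by lia.
apply/arcP/mapP => [[t tm ->]|[t]].
  by exists (i + t); rewrite // mem_iota; lia.
by rewrite mem_iota => ht ->; exists (t - i); [lia | congr f; lia].
Qed.

(** * Genlex cycles of the pancake graph *)

Lemma zaks_listing n (x : {perm 'I_n}) : 0 < n ->
  cyclic_listing n`! (fun m => x ** zaks n m).
Proof. by move=> n0 a b; rewrite (inj_eq (@pmulI _ x)) zaks_inj. Qed.

Lemma left_translate_listing n N (x : {perm 'I_n}) f :
  left_translate x (listing_edges N f) = listing_edges N (fun m => x ** f m).
Proof.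
rewrite /left_translate /listing_edges -imset_comp; apply: eq_imset => m /=.
by rewrite imsetU !imset_set1.
Qed.

Lemma zaks_cycle n : 2 <= n ->
  tower_cycle (zaks_tower n) = listing_edges n`! (zaks n).
Proof.
move=> n2; apply: eq_imset => m /=.
by rewrite !zaks_prefix ?(ltnW (ltn_ord m)).
Qed.

Lemma tail_class_pmul n k (x y z : {perm 'I_n}) :
  (x ** y \in tail_class k (x ** z)) = (y \in tail_class k z).
Proof.
rewrite !inE; apply: eq_forallb => i.
by rewrite !pmulE (inj_eq perm_inj).
Qed.

Lemma zaks_genlex n (x : {perm 'I_n}) : 0 < n ->
  genlex (listing_edges n`! (fun m => x ** zaks n m)).
Proof.
move=> n0; have fP := zaks_listing x n0.
exists (mkseq (fun m => x ** zaks n m) n`!); first exact: listing_traverses.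
move=> k pi /andP[k0 kn]; have [a aN <-] := listing_onto pi fP.
have f0 := fact_gt0 k.
have kd : k`! %| n`! by apply: leq_dvdn_fact.
have aq : a %/ k`! < n`! %/ k`! by rewrite ltn_divLR // divnK.
have bound : a %/ k`! * k`! + k`! <= n`!.
  by rewrite -mulSnr -(divnK kd) leq_mul2r aq orbT.
suff -> : tail_class k (x ** zaks n a)
    = listing_arc (fun m => x ** zaks n m) (a %/ k`! * k`!) k`!.
  exact: contiguous_mkseq.
apply/setP => y; have [b bN <-] := listing_onto y fP.
rewrite tail_class_pmul zaks_tail //.
apply/eqP/arcP => [e|[t tk /pmulI/eqP]].
  by exists (b %% k`!); rewrite ?ltn_mod // -e -divn_eq.
rewrite zaks_inj // !modn_small //; last by lia.
by move/eqP->; rewrite divnMDl // (divn_small tk) addn0.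
Qed.

Lemma zaks_pancake n (x : {perm 'I_n}) : 2 <= n ->
  listing_edges n`! (fun m => x ** zaks n m)
    \subset cayley_edges (pancake_gens n).
Proof.
move=> n2; apply/subsetP => e /imsetP[m _ ->] /=.
apply/imset2P; exists (x ** zaks n m) (pancake_flip n (ruler n m.+1)).
- by [].
- apply/pancake_gensP; exists (ruler n m.+1) => //.
  by rewrite ruler_gt1 // ruler_le.
by rewrite pmulA.
Qed.

Lemma pancake_edge n (x y : {perm 'I_n}) : x != y ->
  [set x; y] \in cayley_edges (pancake_gens n) ->
  exists2 k, 2 <= k <= n & y = x ** pancake_flip n k.
Proof.
move=> xy /imset2P[z g _ /pancake_gensP[k hk ->] e]; exists k => //.
have : x \in [set x; y] by rewrite set21.
have : y \in [set x; y] by rewrite set22.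
rewrite e => /set2P[ey|ey] /set2P[ex|ex] //; try by rewrite ex ey eqxx in xy.
- by rewrite ex ey -pmulA flipK /pmul mul1g.
- by rewrite ex ey.
Qed.

Lemma card_tail_class n k (x : {perm 'I_n}) : k <= n ->
  #|tail_class k x| = k`!.
Proof.
move=> kn; have -> : tail_class k x = [set x ** y | y in symG n k].
  apply/setP => y; apply/idP/imsetP => [|[z zS ->]].
    rewrite inE => /forallP yx; exists (x^-1%g ** y); last first.
      by rewrite pmulA /pmul mulVg mulg1.
    apply/symGP => i ki; rewrite pmulE.
    by have /implyP/(_ ki)/eqP-> := yx i; rewrite permK.
  rewrite inE; apply/forallP => i; apply/implyP => ki.
  by have /symGP/(_ i ki) zi := zS; rewrite pmulE zi.
rewrite card_imset; last exact: pmulI.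
rewrite card_Sym; congr factorial.
have wi : injective (widen_ord kn) by move=> i j [] /val_inj.
rewrite -[RHS](card_ord k) -(card_imset _ wi).
apply: eq_card => i; rewrite inE; apply/idP/imsetP => [ik|[j _ ->]] //=.
by exists (Ordinal ik) => //; apply: val_inj.
Qed.

Lemma tail_class_refl n k (x : {perm 'I_n}) : x \in tail_class k x.
Proof. by rewrite inE; apply/forallP => i; rewrite eqxx implybT. Qed.

Lemma tail_class_eq n k (x y : {perm 'I_n}) :
  x \in tail_class k y -> tail_class k x = tail_class k y.
Proof.
rewrite inE => /forallP xy; apply/setP => z; rewrite !inE.
apply: eq_forallb => i; have := xy i.
by case: (k <= i) => //= /eqP->.
Qed.

Lemma tail_class_sub n k l (x : {perm 'I_n}) :
  k <= l -> tail_class k x \subset tail_class l x.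
Proof.
move=> kl; apply/subsetP => y; rewrite !inE => /forallP xy.
apply/forallP => i; apply/implyP => li; apply: (implyP (xy i)).
exact: leq_trans li.
Qed.

(** Tail classes are the cosets of [G_k], and [r_l] lies in [G_k] iff
    [l <= k]. *)
Lemma tail_class_flip n k l (x : {perm 'I_n}) : 2 <= l <= n ->
  (x \in tail_class k (x ** pancake_flip n l)) = (l <= k).
Proof.
move=> hl; have -> : x = x ** 1%g by rewrite /pmul mul1g.
rewrite -pmulA tail_class_pmul /pmul mulg1.
have -> : (1%g \in tail_class k (pancake_flip n l))
    = (pancake_flip n l \in symG n k).
  rewrite inE; apply/forallP/symGP => [h i ki|h i]; last first.
    by apply/implyP => ki; rewrite perm1 h.
  by have /implyP/(_ ki) := h i; rewrite perm1 => /eqP <-.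
have [lk|kl] := leqP l k; first by rewrite flip_symG //; lia.
by apply/negbTE/flip_notin_symG.
Qed.

(** One place where the walk enters a coset of [G_k] suffices: cosets being arcs
    of [k!] vertices, the walk then enters a new coset exactly every [k!]
    steps. *)
Lemma aligned_blocks n (g : nat -> {perm 'I_n}) k : 1 <= k < n ->
  cyclic_listing n`! g ->
  (forall pi, exists i m, tail_class k pi = listing_arc g i m) ->
  g n`!.-1 \notin tail_class k (g n`!) ->
  forall a, (g a \in tail_class k (g a.+1)) = ~~ (k`! %| a.+1).
Proof.
move=> /andP[k0 kn] gP gA g0; have N0 := fact_gt0 n; have f0 := fact_gt0 k.
have kN : k`! < n`! by rewrite ltn_fact.
have gN a : g (n`! + a) = g a by apply: (listing_congr gP); rewrite modnDl.
have block b : g b \notin tail_class k (g b.+1) ->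
    tail_class k (g b.+1) = listing_arc g b.+1 k`!.
  have [i [m e]] := gA (g b.+1); rewrite -(card_tail_class (g b.+1) (ltnW kn)).
  move=> gb; have := tail_class_refl k (g b.+1).
  by rewrite e in gb *; apply: arc_entry.
(* Adding [n!] leaves the vertex unchanged and makes the predecessor of position
   0 a legitimate index. *)
have entry j : g (n`! + j * k`!).-1 \notin tail_class k (g (n`! + j * k`!)).
  elim: j => [|j IHj]; first by rewrite mul0n addn0.
  set b := n`! + j * k`! in IHj; have b0 : 0 < b by rewrite /b; lia.
  have e : n`! + j.+1 * k`! = b + k`! by rewrite /b mulSnr; lia.
  have := block b.-1; rewrite prednK // => /(_ IHj) bE.
  have last_in : g (b + k`!).-1 \in tail_class k (g b).
    by rewrite bE; apply/arcP; exists k`!.-1; [lia | congr g; lia].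
  rewrite e; apply/negP => /tail_class_eq eq_t.
  have : g (b + k`!) \in tail_class k (g b).
    by rewrite -(tail_class_eq last_in) eq_t tail_class_refl.
  rewrite bE => /arcP[t tk /eqP].
  rewrite gP eqn_modDl !modn_small //; last by lia.
  by move/eqP; lia.
have blockE j :
    tail_class k (g (n`! + j * k`!)) = listing_arc g (n`! + j * k`!) k`!.
  have := block (n`! + j * k`!).-1; rewrite prednK; last by lia.
  by apply; apply: entry.
move=> a; have [/dvdnP[j aj]|na] := boolP (k`! %| a.+1).
  apply/negbTE; rewrite -(gN a) -(gN a.+1) aj.
  by have := entry j; rewrite -aj addnS.
have tk : (a %% k`!).+1 < k`!.
  rewrite ltn_neqAle ltn_mod f0 andbT; apply: contra na => /eqP e.
  by rewrite {1}(divn_eq a k`!) -addnS e dvdn_add ?dvdn_mull.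
have inB t : t < k`! -> g (a %/ k`! * k`! + t)
    \in tail_class k (g (n`! + a %/ k`! * k`!)).
  by move=> lt; rewrite blockE -gN addnA; apply/arcP; exists t.
have := inB _ tk; rewrite addnS -divn_eq => /tail_class_eq->.
by have := inB _ (ltnW tk); rewrite -divn_eq.
Qed.

(** The positions where the walk leaves a coset of [G_k] determine the label of
    every step. *)
Lemma genlex_pancake n (E : {set {set {perm 'I_n}}}) : 2 <= n ->
  E \subset cayley_edges (pancake_gens n) -> genlex E ->
  exists x : {perm 'I_n}, E = listing_edges n`! (fun m => x ** zaks n m).
Proof.
move=> n2 sE [s ts arcs]; have N0 := fact_gt0 n.
have nf : n`! = n * n.-1`! by case: n n2 {E sE s ts arcs N0}.
have f0 := fact_gt0 n.-1.
have nn : n.-1`! < n`! by rewrite nf; nia.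
have [f [fP EE fA]] := traverses_listing ts; rewrite {}EE in sE *.
(* The new origin [i] is the first position of some coset of [G_(n-1)]. *)
have [i [m eA]] := fA _ (arcs n.-1 (f 0) ltac:(lia)).
have cA : #|tail_class n.-1 (f 0)| = n.-1`!.
  by rewrite card_tail_class ?leq_pred.
have mN : m < n`!.
  rewrite ltnNge; apply/negP => Nm; move: nn; rewrite -cA ltnNge => /negP[].
  rewrite -card_Sn; apply: subset_leq_card; apply/subsetP => x _.
  by have [a _ <-] := listing_onto x fP; rewrite eA (mem_long_arc _ _ fP).
have mE : m = n.-1`! by rewrite -cA eA (card_arc _ fP) // ltnW.
pose g t := f (i + t).
have gP : cyclic_listing n`! g := cyclic_listing_shift i fP.
have gA k pi : 1 <= k < n -> exists j l, tail_class k pi = listing_arc g j l.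
  move=> /andP[k0 kn]; have [j [l ->]] := fA _ (arcs k pi ltac:(lia)).
  by have [j' e] := arc_shift i j l fP N0; exists j', l.
have gN : g n`! = g 0 by apply: (listing_congr gP); rewrite modnn mod0n.
have g0 : g n`! \in tail_class n.-1 (f 0).
  by rewrite gN eA; apply/arcP; exists 0; rewrite ?mE.
have gN1 : g n`!.-1 \notin tail_class n.-1 (g n`!).
  rewrite (tail_class_eq g0) eA; apply/negP => /arcP[t tm /eqP].
  by rewrite (gP _ t) !modn_small; [move/eqP; lia | lia | lia].
rewrite -(listing_edges_shift i fP N0) -/g in sE *.
have step a : g a.+1 = g a ** pancake_flip n (ruler n a.+1).
  have ga : g a != g a.+1.
    rewrite gP -[X in X == _ %[mod _]]addn0 -addn1 eqn_modDl mod0n.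
    by rewrite modn_small //; lia.
  have /(subsetP sE)/(pancake_edge ga) [l hl gl] :
      [set g a; g a.+1] \in listing_edges n`! g.
    by apply/(mem_listing_edges _ gP N0); exists a.
  rewrite gl; congr (_ ** pancake_flip n _); apply: ruler_unique => // k hk.
  apply: negb_inj; rewrite -leqNgt -(tail_class_flip _ (g a)) // -gl.
  apply: aligned_blocks => // [pi|]; first exact: gA.
  by apply: contra gN1; apply/subsetP/tail_class_sub; lia.
exists (g 0); apply: eq_imset => a; rewrite /=.
have gE b : g b = g 0 ** zaks n b.
  elim: b => [|b IHb]; first by rewrite /pmul mul1g.
  by rewrite step IHb -pmulA.
by congr [set _; _]; apply: gE.
Qed.

(** * Counting the translates *)

Lemma left_translateM n (x y : {perm 'I_n}) E :
  left_translate (x ** y) E = left_translate x (left_translate y E).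
Proof. exact: (actM ('R^*)^* E y x). Qed.

(** The two ends of the [q]-th block of [(n-1)!] positions: the first position for
    [b = false], the last one for [b = true]. *)
Definition block_end n (qb : 'I_n * bool) : nat :=
  qb.1 * n.-1`! + qb.2 * n.-1`!.-1.

Definition block_ends n : {set {perm 'I_n}} :=
  [set zaks n (block_end qb) | qb : 'I_n * bool].

(** For [n >= 3] a block has at least two positions, so its ends differ. *)
Lemma card_block_ends n : 3 <= n -> #|block_ends n| = n.*2.
Proof.
move=> n3; have n0 : 0 < n by lia.
have L2 : 1 < n.-1`! by rewrite (@ltn_fact 1) //; lia.
rewrite card_imset ?card_prod ?card_ord ?card_bool ?muln2 //.
have nf : n`! = n * n.-1`! by case: n n3 {n0 L2}.
have bound (qb : 'I_n * bool) : block_end qb < n`!.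
  case: qb => q b; rewrite /block_end nf /=; have := ltn_ord q.
  by case: b => /=; nia.
have L0 : 0 < n.-1`! by apply: fact_gt0.
have small (b : bool) : b * n.-1`!.-1 < n.-1`! by case: b => /=; lia.
move=> [q b] [q' b'] /eqP; rewrite zaks_inj // !modn_small //.
rewrite /block_end /= => /eqP e.
have eq_q : q = q'.
  apply: val_inj => /=; have := congr1 (divn^~ n.-1`!) e.
  by rewrite !divnMDl // !divn_small // !addn0.
move: e; rewrite eq_q => /addnI; case: b b' => [] [] //=; lia.
Qed.

Lemma translate_zaks_period n d : 2 <= n -> n.-1`! %| d ->
  left_translate (zaks n d) (listing_edges n`! (zaks n))
  = listing_edges n`! (zaks n).
Proof.
move=> n2 dL; have n0 := ltnW n2.
have zP : cyclic_listing n`! (zaks n) by move=> a b; apply: zaks_inj.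
rewrite left_translate_listing -(listing_edges_shift d zP) ?fact_gt0 //.
by apply: eq_imset => m; rewrite !zaks_period.
Qed.

Lemma translate_zaks_flip n : 2 <= n ->
  left_translate (pancake_flip n n) (listing_edges n`! (zaks n))
  = listing_edges n`! (zaks n).
Proof.
move=> n2; have n0 := ltnW n2; have f0 := fact_gt0 n.
have zP : cyclic_listing n`! (zaks n) by move=> a b; apply: zaks_inj.
(* Translation preserves the number of edges, so an inclusion suffices. *)
have sub : left_translate (pancake_flip n n) (listing_edges n`! (zaks n))
    \subset listing_edges n`! (zaks n).
  rewrite left_translate_listing.
  apply/subsetP => _ /imsetP[m _ ->]; apply/(mem_listing_edges _ zP f0).
  have mN := ltn_ord m; rewrite /= zaks_reflect //.
  have [m1N|Nm] := ltnP m.+1 n`!.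
    rewrite -[zaks n m ** _]/(zaks n m.+1) (zaks_reflect n0 m1N) setUC.
    exists (n`!.-1 - m.+1).
    by have -> : n`!.-1 - m = (n`!.-1 - m.+1).+1 by lia.
  have {Nm} mE : m.+1 = n`! by apply/eqP; rewrite eqn_leq mN.
  have -> : n`!.-1 - m = 0 by lia.
  exists n`!.-1; rewrite -[zaks n m ** _]/(zaks n m.+1) mE.
  rewrite -[RHS]/[set zaks n n`!.-1; zaks n n`!.-1.+1] prednK // zaks_full //.
  by rewrite zaks_fact_pred ?n0 ?leqnn // /pmul mul1g setUC.
apply/eqP; rewrite eqEcard sub [leqRHS]card_imset ?leqnn //.
by apply: imset_inj; apply: pmulI.
Qed.

(** A translation preserving the cycle maps the edge labelled [r_n] that ends
    at the identity to another edge labelled [r_n]. *)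
Lemma translate_zaks_fixed n (x : {perm 'I_n}) : 3 <= n ->
  left_translate x (listing_edges n`! (zaks n)) = listing_edges n`! (zaks n)
  <-> x \in block_ends n.
Proof.
move=> n3; have n2 := ltnW n3; have n0 := ltnW n2; have f0 := fact_gt0 n.
have zP : cyclic_listing n`! (zaks n) by move=> a b; apply: zaks_inj.
have L0 := fact_gt0 n.-1.
have nf : n`! = n * n.-1`! by case: n n3 {x n2 n0 zP f0 L0}.
split=> [e|/imsetP[[q b] _ ->]]; last first.
  rewrite /block_end /=; case: b; last first.
    by rewrite mul0n addn0 translate_zaks_period // dvdn_mull.
  (* The last vertex of a block is the first vertex of the next one, times the
     reversal [r_n] that joins them. *)
  have -> : zaks n (q * n.-1`! + 1 * n.-1`!.-1)
      = zaks n (q.+1 * n.-1`!) ** pancake_flip n n.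
    have e : q.+1 * n.-1`! = (q * n.-1`! + 1 * n.-1`!.-1).+1.
      by rewrite mulSn; lia.
    rewrite e /= -e.
    rewrite (@ruler_top n (q.+1 * n.-1`!)) ?dvdn_mull //.
    by rewrite -pmulA flipK /pmul mul1g.
  rewrite left_translateM translate_zaks_flip //.
  by rewrite translate_zaks_period // dvdn_mull.
have : [set x ** zaks n n`!.-1; x ** zaks n n`!] \in listing_edges n`! (zaks n).
  rewrite -e left_translate_listing.
  apply/mem_listing_edges => //; first exact: zaks_listing.
  by exists n`!.-1; rewrite prednK.
rewrite zaks_full // zaks_fact_pred ?n0 ?leqnn // => /imsetP[[a aN] _ /=].
set r := ruler n a.+1; move=> ea.
have x1 : x ** 1%g = x by rewrite /pmul mul1g.
rewrite x1 in ea.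
have : x \in [set zaks n a; zaks n a ** pancake_flip n r] by rewrite -ea set22.
have : x ** pancake_flip n n \in [set zaks n a; zaks n a ** pancake_flip n r].
  by rewrite -ea set21.
have xn : x ** pancake_flip n n != x.
  rewrite -[X in _ != X]x1 (inj_eq (@pmulI _ x)) -(flip1 n).
  by apply/eqP => /(@flip_inj n n 1); lia.
have r2 : 2 <= r <= n by rewrite ruler_gt1 // ruler_le.
have finish : r = n -> x = zaks n a \/ x = zaks n a.+1 -> x \in block_ends n.
  move=> rn; have /dvdnP[q qE] : n.-1`! %| a.+1.
    have Ln : n.-1 < n by lia.
    by rewrite -(ltn_ruler _ Ln) -/r rn.
  have q0 : 0 < q by case: q qE.
  have qn : q <= n by rewrite -(leq_pmul2r L0) -qE -nf.
  case=> ->; apply/imsetP.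
    have hq : q.-1 < n by lia.
    exists (Ordinal hq, true) => //; congr zaks; rewrite /block_end /=.
    by case: q q0 qE {qn hq} => //= q _; rewrite mulSn; lia.
  rewrite qE; have [qlt|nq] := ltnP q n.
    by exists (Ordinal qlt, false) => //; rewrite /block_end /= mul0n addn0.
  have -> : q = n by lia.
  by exists (Ordinal n0, false) => //; rewrite -nf zaks_full // /block_end.
case/set2P=> e1 /set2P[] e2.
- by rewrite e1 e2 eqxx in xn.
- apply: finish; last by right.
  apply/esym/(flip_inj _ _ (n := n)); try lia.
  by apply: (@pmulI _ x); rewrite e1 e2 -pmulA flipK /pmul mul1g.
- apply: finish; last by left.
  apply/esym/(flip_inj _ _ (n := n)); try lia.
  by apply: (@pmulI _ x); rewrite e1 e2.
- by rewrite e1 e2 eqxx in xn.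
Qed.

Lemma card_zaks_translates n : 3 <= n ->
  #|[set left_translate x (tower_cycle (zaks_tower n)) | x : {perm 'I_n}]|
    = n.-1`! %/ 2.
Proof.
move=> n3; have n2 := ltnW n3; have n0 := ltnW n2; rewrite zaks_cycle //.
set C := listing_edges _ _.
(* The product of the group composes from left to right, so left translation is
   its action by right multiplication, lifted twice: to sets of vertices, then to
   sets of edges. *)
have -> : [set left_translate x C | x : {perm 'I_n}]
    = orbit ('R^*)^* [set: {perm 'I_n}] C.
  by apply/setP => E; apply/imsetP/imsetP => -[x _ ->]; exists x.
rewrite card_orbit setTI.
have stabE : 'C[C | ('R^*)^*]%g = block_ends n.
  apply/setP => x; apply/astab1P/idP; last by move/(translate_zaks_fixed x n3).
  by move/(translate_zaks_fixed x n3).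
have := Lagrange (subsetT 'C[C | ('R^*)^*]%G).
rewrite /= stabE card_block_ends // cardsT card_Sn.
have nf : n`! = n * n.-1`! by case: n n3 {n2 n0 C stabE}.
rewrite nf -muln2 -mulnA => /eqP; rewrite eqn_pmul2l // => /eqP <-.
by rewrite mulKn.
Qed.

Theorem corollary6p1 (n : nat) (hn : 3 <= n) :
  (forall g : n.-1.-tuple {perm 'I_n},
     (is_tower g /\ (forall x, x \in g -> x \in pancake_gens n))
     <-> g = zaks_tower n)
  /\
  (forall E : {set {set {perm 'I_n}}},
     (hamiltonian_cycle E /\ E \subset cayley_edges (pancake_gens n) /\ genlex E)
     <-> E \in [set left_translate x (tower_cycle (zaks_tower n))
               | x : {perm 'I_n}])
  /\
  #|[set left_translate x (tower_cycle (zaks_tower n)) | x : {perm 'I_n}]|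
    = (n.-1)`! %/ 2.
Proof.
have n2 := ltnW hn; have n0 := ltnW n2; split; [|split].
- move=> g; split=> [[]|->]; first exact: pancake_tower.
  by split; [apply: zaks_is_tower | move=> x; apply: zaks_in_pancake].
- move=> E; split=> [[_ [sE gE]]|/imsetP[x _ ->]].
    have [x ->] := genlex_pancake n2 sE gE.
    apply/imsetP; exists x => //.
    by rewrite zaks_cycle // left_translate_listing.
  rewrite zaks_cycle // left_translate_listing; split; last first.
    by split; [apply: zaks_pancake | apply: zaks_genlex].
  exists (mkseq (fun m => x ** zaks n m) n`!).
  exact/listing_traverses/zaks_listing.
- exact: card_zaks_translates.
Qed.
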